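(* Let $X\subset\mathbb{R}^n$ be open, let $\mathcal{M}\subset\mathcal{J}^2$ be a monotonicity cone subequation, and let $(F,\mathcal{G})$ be an $\mathcal{M}$-monotone pair with $\mathcal{G}$ fiberegular. Suppose that $F$ satisfies the regularity condition: for some fixed $J_0\in\operatorname{int}\mathcal{M}$, given $\Omega\Subset X$ and $\eta>0$, there exists $\delta=\delta(\eta,\Omega)>0$ such that $$F(y,J+\eta J_0)\ge F(x,J)\quad\text{for all }J\in\mathcal{G}_x\text{ and all }x,y\in\Omega\text{ with }|x-y|<\delta.$$ Then the constraint set $$\mathcal{F}:=\{(x,J)\in\mathcal{G}:F(x,J)\ge0\}$$ is a fiberegular $\mathcal{M}$-monotone subequation on $X$. Moreover, the fibers of $\mathcal{F}$ are nonempty if one assumes that $\{J\in\mathcal{G}_x:F(x,J)=0\}\ne\emptyset$ for each $x\in X$. Each fiber $\mathcal{F}_x$ is not all of $\mathcal{J}^2$ in the constrained case, and also in the unconstrained case if one assumes that $\{J\in\mathcal{J}^2:F(x,J)<0\}\ne\emptyset$ for each $x\in X$.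
   Context: $\mathcal{S}(n)$ is the space of real symmetric $n\times n$ matrices with its usual partial order; $\mathcal{J}^2=\mathbb{R}\times\mathbb{R}^n\times\mathcal{S}(n)$; $\mathcal{J}^2(X)=X\times\mathcal{J}^2$, and for $\mathcal{G}\subset\mathcal{J}^2(X)$, $\mathcal{G}_x=\{J:(x,J)\in\mathcal{G}\}$. $\Omega\Subset X$ means $\Omega$ is open with compact closure contained in $X$. Subequation: $\mathcal{G}\subset\mathcal{J}^2(X)$ is a subequation on $X$ if for all $x\in X$: (P) $(r,p,A)\in\mathcal{G}_x\Rightarrow(r,p,A+P)\in\mathcal{G}_x$ for all $P\ge0$; (N) $(r,p,A)\in\mathcal{G}_x\Rightarrow(r+s,p,A)\in\mathcal{G}_x$ for all $s\le0$; (T) $\mathcal{G}=\overline{\operatorname{int}\mathcal{G}}$, $\mathcal{G}_x=\overline{\operatorname{int}(\mathcal{G}_x)}$ and $(\operatorname{int}\mathcal{G})_x=\operatorname{int}(\mathcal{G}_x)$. Monotonicity cone subequation: a nonempty closed convex cone $\mathcal{M}\subset\mathcal{J}^2$ with vertex at the origin satisfying (P), (N) and $\mathcal{M}=\overline{\operatorname{int}\mathcal{M}}$. $\mathcal{G}$ is $\mathcal{M}$-monotone if $\mathcal{G}_x+\mathcal{M}\subset\mathcal{G}_x$ for all $x$. $\mathcal{M}$-monotone pair $(F,\mathcal{G})$: $\mathcal{G}$ is either $\mathcal{J}^2(X)$ (unconstrained case) or an $\mathcal{M}$-monotone subequation $\mathcal{G}\subsetneq\mathcal{J}^2(X)$ (constrained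 case), and $F\in C(\mathcal{G})$ satisfies $F(x,J+J')\ge F(x,J)$ for all $x\in X$, $J\in\mathcal{G}_x$, $J'\in\mathcal{M}$. In the constrained case each fiber $\mathcal{G}_x$ is assumed to be a proper subset of $\mathcal{J}^2$. Fiberegular: the map $x\mapsto\mathcal{G}_x$ is continuous from $X$ to the closed subsets of $\mathcal{J}^2$ with the Hausdorff distance $d_{\mathscr{H}}$ induced by the norm $\|(r,p,A)\|=\max\{|r|,|p|,\max_k|\lambda_k(A)|\}$, $\lambda_k(A)$ the eigenvalues of $A$ (with $d_{\mathscr{H}}(\emptyset,\emptyset)=0$ and $d_{\mathscr{H}}(\emptyset,A)=+\infty$ for $A\ne\emptyset$). In the unconstrained case fiberegularity of $\mathcal{G}$ is automatic. *)

(* Defs.v *)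
From HB Require Import structures.
From mathcomp Require Import all_boot all_order all_algebra.
From mathcomp Require Import all_classical all_reals all_analysis.

Set Implicit Arguments.
Unset Strict Implicit.
Unset Printing Implicit Defensive.

Import Order.TTheory GRing.Theory Num.Theory.
Import numFieldNormedType.Exports.

Local Open Scope classical_set_scope.
Local Open Scope ring_scope.

(* The space S(n) of real symmetric matrices. *)
Record symm (R : realType) (n : nat) :=
  Symm { symm_val :> 'M[R]_n ; _ : symm_val \is symmetricmx }.

Section SymmStructure.
Variables (R : realType) (n : nat).

HB.instance Definition _ := [isSub for @symm_val R n].
HB.instance Definition _ := [Choice of symm R n by <:].

Fact symm_closed :
  GRing.subsemimod_closed (fun A : 'M[R]_n => A \is symmetricmx).
Proof.
have E (A : 'M[R]_n) : (A \is symmetricmx) = (A == A^T).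
  by rewrite is_hermitianmxE expr0 scale1r map_mx_id.
split; first split.
- by change ((0 : 'M[R]_n) \is symmetricmx); rewrite E trmx0.
- move=> A B; change (A \is symmetricmx -> B \is symmetricmx ->
    A + B \is symmetricmx).
  by rewrite !E raddfD/= => /eqP <- /eqP <-.
- move=> a A; change (A \is symmetricmx -> a *: A \is symmetricmx).
  by rewrite !E linearZ/= => /eqP <-.
Qed.

HB.instance Definition _ :=
  GRing.SubChoice_isSubLmodule.Build R 'M[R]_n _ (symm R n) symm_closed.

(* This norm, inherited from 'M[R]_n, only serves to give S(n) its usual
   topology; the norm of the Hausdorff distance is [jet_norm] below. *)
Let symm_norm (A : symm R n) : R := `|symm_val A|.

Let ler_symm_normD (A B : symm R n) :
  symm_norm (A + B) <= symm_norm A + symm_norm B.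
Proof. exact: ler_normD. Qed.

Let symm_normZ (a : R) (A : symm R n) :
  symm_norm (a *: A) = `|a| * symm_norm A.
Proof. exact: normrZ. Qed.

Let symm_norm0_eq0 (A : symm R n) : symm_norm A = 0 -> A = 0.
Proof. by move=> /normr0_eq0 A0; exact: val_inj. Qed.

HB.instance Definition _ :=
  Lmodule_isNormed.Build R (symm R n) ler_symm_normD symm_normZ symm_norm0_eq0.

End SymmStructure.

Section Subequations.
Variables (R : realType) (n : nat).

Definition psd (A : symm R n) : Prop :=
  forall v : 'rV[R]_n, 0 <= (v *m symm_val A *m v^T) 0 0.

(* The norm of the library on 'rV[R]_n is the maximum norm. *)
Definition eucl_norm (v : 'rV[R]_n) : R :=
  Num.sqrt (\sum_(i < n) v 0 i ^+ 2).

(* The supremum is a maximum: a symmetric matrix has finitely many eigenvalues,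
   and at least one if 0 < n (for n = 0 the value is sup set0 = 0). *)
Definition eig_norm (A : symm R n) : R :=
  sup [set `|l| | l in [set l : R | eigenvalue (symm_val A) l]].

Definition J2 : Type := (R^o * 'rV[R]_n * symm R n)%type.

HB.instance Definition _ := NormedModule.on J2.

Definition jet_norm (J : J2) : R :=
  Num.max `|J.1.1| (Num.max (eucl_norm J.1.2) (eig_norm J.2)).

(* The outer maximum with 0 is there for A = B = set0, where both suprema
   are -oo. *)
Definition hausdorff_dist (A B : set J2) : \bar R :=
  let excess (C D : set J2) : \bar R :=
    ereal_sup [set ereal_inf [set (jet_norm (J - J'))%:E | J' in D] | J in C] in
  Order.max 0%E (Order.max (excess A B) (excess B A)).

(* J^2(X); the fiber of G over x is [xsection G x]. *)
Definition jets (X : set 'rV[R]_n) : set ('rV[R]_n * J2) :=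
  [set z | X z.1].

Definition axiomP (E : set J2) : Prop :=
  forall r p A P, E (r, p, A) -> psd P -> E (r, p, A + P).

Definition axiomN (E : set J2) : Prop :=
  forall r p A (s : R), E (r, p, A) -> s <= 0 -> E (r + s, p, A).

(* Closures are relative to J^2(X), hence the intersection with [jets X].
   Interiors need no such correction, as X is always open here. *)
Definition axiomT (X : set 'rV[R]_n) (G : set ('rV[R]_n * J2)) : Prop :=
  [/\ G = closure G° `&` jets X,
      forall x, X x -> xsection G x = closure (xsection G x)° &
      forall x, X x -> xsection G° x = (xsection G x)°].

Definition subequation (X : set 'rV[R]_n) (G : set ('rV[R]_n * J2)) : Prop :=
  [/\ G `<=` jets X,
      forall x, X x -> axiomP (xsection G x),
      forall x, X x -> axiomN (xsection G x) &
      axiomT X G].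

Definition monotonicity_cone (M : set J2) : Prop :=
  [/\ M !=set0, closed M, convex_set M &
      forall (t : R) J, 0 <= t -> M J -> M (t *: J)] /\
  [/\ axiomP M, axiomN M & M = closure M°].

Definition cone_monotone (X : set 'rV[R]_n) (M : set J2)
    (G : set ('rV[R]_n * J2)) : Prop :=
  forall x J J', X x -> xsection G x J -> M J' -> xsection G x (J + J').

Definition constrained (X : set 'rV[R]_n) (M : set J2)
    (G : set ('rV[R]_n * J2)) : Prop :=
  [/\ subequation X G, cone_monotone X M G, G `<` jets X &
      forall x, X x -> xsection G x != setT].

(* F is a total function, but only its values on G are ever used. *)
Definition monotone_pair (X : set 'rV[R]_n) (M : set J2)
    (F : 'rV[R]_n * J2 -> R) (G : set ('rV[R]_n * J2)) : Prop :=
  [/\ G = jets X \/ constrained X M G,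
      {within G, continuous F} &
      forall x J J', X x -> xsection G x J -> M J' ->
        F (x, J) <= F (x, J + J')].

Definition fiberegular (X : set 'rV[R]_n) (G : set ('rV[R]_n * J2)) : Prop :=
  forall x, X x -> forall e : R, 0 < e ->
    \forall y \near within X (nbhs x),
      (hausdorff_dist (xsection G x) (xsection G y) < e%:E)%E.

Definition compactly_contained (W X : set 'rV[R]_n) : Prop :=
  [/\ open W, compact (closure W) & closure W `<=` X].

(* F (y, J + eta *: J0) only has a meaning if (y, J + eta *: J0) is in G. For
   fiberegular G this holds automatically once d is small enough, so the guard
   on the inequality does not change the condition. *)
Definition fiber_regular_fun (X : set 'rV[R]_n) (F : 'rV[R]_n * J2 -> R)
    (G : set ('rV[R]_n * J2)) (J0 : J2) : Prop :=
  forall (W : set 'rV[R]_n) (eta : R), compactly_contained W X -> 0 < eta ->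
    exists2 d : R, 0 < d &
      forall x y J, W x -> W y -> eucl_norm (x - y) < d -> xsection G x J ->
        xsection G y (J + eta *: J0) -> F (x, J) <= F (y, J + eta *: J0).

Definition constraint_set (F : 'rV[R]_n * J2 -> R) (G : set ('rV[R]_n * J2)) :
    set ('rV[R]_n * J2) :=
  [set z | G z /\ 0 <= F z].

End Subequations.

(* Main.v *)
Require Import Defs.
From mathcomp Require Import all_boot all_order all_algebra.
From mathcomp Require Import all_classical all_reals all_analysis.
From mathcomp Require Import ring.
Import Order.TTheory GRing.Theory Num.Theory.
Import numFieldNormedType.Exports.
Local Open Scope classical_set_scope.
Local Open Scope ring_scope.

(** The proof rests on a reformulation of fiberegularity in which the Hausdorff
distance no longer appears. Since J0 is interior to the cone M, a translation
by a small positive multiple of J0 absorbs any sufficiently small perturbation: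
t J0 + D lies in M as soon as D is small compared with t
([cone_interior_jet_ball]). Hence, for an M-monotone set E, the fibers vary
continuously in Hausdorff distance iff for each eta > 0 and each y close to x

  E_x + eta J0 is contained in E_y   and   E_y + eta J0 is contained in E_x

(the property [translation_regular]; [fiberegular_translation_regular] and
[translation_regular_fiberegular] are the two implications).

In this form the theorem is nearly immediate. The regularity condition on F says
precisely that F does not decrease along the translations that carry G_x into
G_y, so translation regularity passes from G to the constraint set
([constraint_translation_regular]), and fiberegularity of the constraint set
follows. The constraint set is M-monotone because G and F are, and it is closed
in J^2(X) because F is continuous on the relatively closed set G. Finally, a
relatively closed, M-monotone and translation regular set is a subequation
([translation_regular_subequation]). Indeed (P) and (N) express monotonicity
under particular elements of M. For (T), half of the translation by eta J0 moves
a point (x, J) of E to the nearby fibers and the other half provides room inside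
them, so that (x, J + eta J0) is interior to E in the total space; letting
eta tend to 0 exhibits (x, J) as a limit of interior points, and writing an
interior point J of a fiber as (J - t J0) + t J0 shows that (x, J) is interior
to E.

The Hausdorff distance is built on the spectral norm of the matrix component,
whereas topological statements use the entrywise norm. One of the two bounds
between them, [jet_norm_le], is elementary. In place of the other, the axiom (P)
makes it enough to know that A + c I is positive semidefinite when
the eigenvalues of A are at most c in absolute value; this is the variational
characterization of the smallest eigenvalue ([eigenvalues_ge0_bform]). *)

Set Implicit Arguments.
Unset Strict Implicit.
Unset Printing Implicit Defensive.

(** * Entrywise norm of matrices *)

Section MatrixNorm.
Variable R : realType.

Lemma ler_entry_norm m n (A : 'M[R]_(m, n)) i j : `|A i j| <= `|A|.
Proof.
rewrite [leRHS]/Num.Def.normr /= mx_normrE.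
by apply/bigmax_geP; right; exists (i, j).
Qed.

Lemma ler_norm_entries m n (A : 'M[R]_(m, n)) c : 0 <= c ->
  (forall i j, `|A i j| <= c) -> `|A| <= c.
Proof.
move=> c0 Ac; rewrite [leLHS]/Num.Def.normr /= mx_normrE.
by apply/bigmax_leP; split=> // -[i j] _; exact: Ac.
Qed.

Lemma ler_norm_mulmx m n p (A : 'M[R]_(m, n)) (B : 'M[R]_(n, p)) :
  `|A *m B| <= n%:R * (`|A| * `|B|).
Proof.
apply: ler_norm_entries => [|i j]; first by rewrite !mulr_ge0.
rewrite mxE (le_trans (ler_norm_sum _ _ _))//.
rewrite -[n in n%:R]card_ord mulr_natl -sumr_const ler_sum// => k _.
by rewrite normrM ler_pM// ler_entry_norm.
Qed.

Lemma eigenvalue_le_norm n (A : 'M[R]_n) l :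
  eigenvalue A l -> `|l| <= n%:R * `|A|.
Proof.
move=> /eigenvalueP[v vA v0]; have v_gt0 : 0 < `|v| by rewrite normr_gt0.
rewrite -(ler_pM2r v_gt0) -normrZ -vA -mulrA [`|A| * _]mulrC.
exact: ler_norm_mulmx.
Qed.

End MatrixNorm.

(** * Symmetric matrices with nonnegative eigenvalues *)

Section QuadraticForms.
Variables (R : realType) (n : nat).
Implicit Types (A : 'M[R]_n) (u v : 'rV[R]_n).

Definition bform A u v : R := (u *m A *m v^T) 0 0.

Lemma bformE A u v : bform A u v = \sum_j (\sum_i u 0 i * A i j) * v 0 j.
Proof. by rewrite /bform mxE; apply: eq_bigr => j _; rewrite !mxE. Qed.

Lemma bformDl A u1 u2 v : bform A (u1 + u2) v = bform A u1 v + bform A u2 v.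
Proof. by rewrite /bform !mulmxDl mxE. Qed.

Lemma bformZl A t u v : bform A (t *: u) v = t * bform A u v.
Proof. by rewrite /bform -!scalemxAl mxE. Qed.

Lemma bformZZ A t u : bform A (t *: u) (t *: u) = t ^+ 2 * bform A u u.
Proof.
by rewrite /bform linearZ/= -!scalemxAl -scalemxAr !mxE mulrA expr2.
Qed.

Lemma bformB_scalar A m u v :
  bform (A - m%:M) u v = bform A u v - m * bform 1%:M u v.
Proof.
by rewrite /bform mulmxBr mulmxBl mul_mx_scalar mulmx1 -scalemxAl !mxE.
Qed.

Lemma bform0l A v : bform A 0 v = 0.
Proof. by rewrite /bform !mul0mx mxE. Qed.

Lemma bformC A u v : A = A^T -> bform A u v = bform A v u.
Proof.
move=> sA; have -> : bform A u v = (u *m A *m v^T)^T 0 0 by rewrite mxE.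
by rewrite !trmx_mul trmxK -sA mulmxA.
Qed.

Lemma bform1 u : bform 1%:M u u = \sum_i u 0 i ^+ 2.
Proof.
by rewrite /bform mulmx1 mxE; apply: eq_bigr => i _; rewrite mxE expr2.
Qed.

Lemma bform1_ge0 u : 0 <= bform 1%:M u u.
Proof. by rewrite bform1 sumr_ge0// => i _; exact: sqr_ge0. Qed.

Lemma bform1_eq0 u : bform 1%:M u u = 0 -> u = 0.
Proof.
rewrite bform1 => u0; apply/rowP => i; rewrite mxE; apply/eqP.
rewrite -sqrf_eq0; apply/eqP/(psumr_eq0P _ u0) => // j _; exact: sqr_ge0.
Qed.

Lemma continuous_bform A : continuous (fun v => bform A v v).
Proof.
have coord k : continuous (fun v : 'rV[R]_n => v 0 k).
  exact: (@coord_continuous _ _ _ 0 k).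
have row_coord j : continuous (fun v : 'rV[R]_n => \sum_i v 0 i * A i j).
  apply: continuous_big => [|i _ v]; first exact: add_continuous.
  exact: (cvgM (coord i v) (cvg_cst (A i j))).
under eq_fun do rewrite bformE.
apply: continuous_big => [|j _ v]; first exact: add_continuous.
exact: (cvgM (row_coord j v) (coord j v)).
Qed.

Lemma sphere_compact : compact [set v : 'rV[R]_n | bform 1%:M v v = 1].
Proof.
apply: bounded_closed_compact.
  exists 1; split=> [|x x1 v /= v1]; first exact: num_real.
  rewrite (le_trans _ (ltW x1))//.
  apply: ler_norm_entries => // i j; rewrite ord1.
  rewrite -[_ <= _](@ler_pXn2r _ 2) ?nnegrE//.
  rewrite real_normK ?num_real// expr1n -v1 bform1 (bigD1 j)//= lerDl.
  by rewrite sumr_ge0// => k _; exact: sqr_ge0.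
have /continuous_closedP cl := @continuous_bform 1%:M.
exact: (cl _ (@closed_eq _ 1)).
Qed.

Lemma normalize_row u : u != 0 ->
  exists2 t : R, 0 < t & bform 1%:M (t *: u) (t *: u) = 1.
Proof.
move=> u0; have u_gt0 : 0 < bform 1%:M u u.
  rewrite lt_neqAle bform1_ge0 andbT eq_sym.
  by apply: contra_neq u0; exact: bform1_eq0.
exists (Num.sqrt (bform 1%:M u u))^-1; first by rewrite invr_gt0 sqrtr_gt0.
by rewrite bformZZ exprVn sqr_sqrtr ?ltW// mulVf// gt_eqF.
Qed.

(** The value of the form at c + r u with u = c A is 2 r |u|^2 + r^2 A(u, u);
were u nonzero, this would be negative for small negative r. *)
Lemma isotropic_kernel A c : A = A^T -> (forall u, 0 <= bform A u u) ->
  bform A c c = 0 -> c *m A = 0.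
Proof.
move=> sA A0 cc; set u := c *m A.
have cu w : bform A c w = bform 1%:M u w by rewrite /bform mulmx1.
apply: bform1_eq0; apply/eqP; rewrite eq_le bform1_ge0 andbT.
have quad r : 0 <= 2 * r * bform 1%:M u u + r ^+ 2 * bform A u u.
  have := A0 (c + r *: u).
  rewrite bformDl [bform _ c _]bformC// [bform _ (r *: u) _]bformC//.
  rewrite !bformDl !bformZl !(bformC _ (r *: u))// !bformZl cc.
  rewrite (bformC u c)// cu.
  move=> /le_trans; apply; rewrite le_eqVlt; apply/orP; left; apply/eqP.
  by ring.
move: (A0 u) quad; set b := bform A u u; set s := bform 1%:M u u => b0 quad.
have b1 : 0 < b + 1 by rewrite ltr_wpDl.
(* The minimum over r is at - s / b; b + 1 replaces b, which may vanish. *)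
have := quad (- s / (b + 1)).
have -> : 2 * (- s / (b + 1)) * s + (- s / (b + 1)) ^+ 2 * b =
   - (s ^+ 2 * (b + 2)) / (b + 1) ^+ 2.
  by field; rewrite gt_eqF.
rewrite pmulr_lge0 ?invr_gt0 ?exprn_gt0// oppr_ge0 pmulr_lle0; last first.
  by rewrite ltr_wpDl.
move=> s_le0; have : s ^+ 2 == 0 by rewrite eq_le s_le0 sqr_ge0.
by rewrite sqrf_eq0 => /eqP->.
Qed.

(** The minimum m of the quadratic form on the Euclidean unit sphere is attained
at some c. The form of A - m I is nonnegative and vanishes at c, hence c lies in
its kernel: m is an eigenvalue of A, and so nonnegative. *)
Lemma eigenvalues_ge0_bform A : A = A^T ->
  (forall l, eigenvalue A l -> 0 <= l) -> forall v, 0 <= bform A v v.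
Proof.
move=> sA eA v; rewrite leNgt; apply/negP => qv.
have v0 : v != 0 by apply/eqP => v0; move: qv; rewrite v0 bform0l ltxx.
have [t t0 tv] := normalize_row v0.
have [c] : exists2 c, c \in [set v : 'rV[R]_n | bform 1%:M v v = 1] &
    forall u, u \in [set v : 'rV[R]_n | bform 1%:M v v = 1] ->
      bform A c c <= bform A u u.
  apply: EVT_min_rV; [by exists (t *: v)|exact: sphere_compact|].
  exact/continuous_subspaceT/continuous_bform.
rewrite inE /= => c1 cmin; set m := bform A c c in cmin.
have m0 : m < 0.
  rewrite (le_lt_trans (cmin (t *: v) _)) ?inE// bformZZ pmulr_rlt0//.
  by rewrite exprn_gt0.
have qm u : 0 <= bform (A - m%:M) u u.
  have [->|u0] := eqVneq u 0; first by rewrite bform0l.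
  have [s s0 su] := normalize_row u0.
  rewrite -(@pmulr_rge0 _ (s ^+ 2)) ?exprn_gt0// -bformZZ bformB_scalar su.
  by rewrite mulr1 subr_ge0; apply: cmin; rewrite inE.
have sB : A - m%:M = (A - m%:M)^T by rewrite linearB/= tr_scalar_mx -sA.
have cB : c *m (A - m%:M) = 0.
  by apply: isotropic_kernel; rewrite // bformB_scalar c1 mulr1 subrr.
suff /eA : eigenvalue A m by rewrite leNgt m0.
apply/eigenvalueP; exists c.
  by apply/eqP; rewrite -subr_eq0 -mul_mx_scalar -mulmxBr cB.
by apply/eqP => c0; move: c1; rewrite c0 bform0l => /esym/eqP; rewrite oner_eq0.
Qed.

End QuadraticForms.

(** * Jet norm and interior of a monotonicity cone *)

Section JetNorm.
Variables (R : realType) (n : nat).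
Implicit Types (A : symm R n) (J D : J2 R n).

Lemma symm_trmx A : symm_val A = (symm_val A)^T.
Proof.
have := valP A; rewrite /= is_hermitianmxE expr0 scale1r map_mx_id//.
by move=> /eqP.
Qed.

Lemma scalar_symm (c : R) : (c%:M : 'M[R]_n) \is symmetricmx.
Proof. by rewrite is_hermitianmxE expr0 scale1r map_mx_id// tr_scalar_mx. Qed.

Definition scalar_symmetric (c : R) : symm R n := Symm (scalar_symm c).

Lemma eig_norm_ge A l : eigenvalue (symm_val A) l -> `|l| <= eig_norm A.
Proof.
move=> Al; apply: ub_le_sup; last by exists l.
by exists (n%:R * `|symm_val A|) => _ [k Ak <-]; exact: eigenvalue_le_norm.
Qed.

Lemma eig_norm_le A : eig_norm A <= n%:R * `|A|.
Proof.
rewrite /eig_norm; set S := [set _ | _ in _].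
have [->|S0] := eqVneq S set0; first by rewrite sup0 mulr_ge0.
apply: ge_sup; first exact/set0P.
by move=> _ [k Ak <-]; exact: eigenvalue_le_norm.
Qed.

Lemma eucl_norm_le (v : 'rV[R]_n) : eucl_norm v <= n%:R * `|v|.
Proof.
rewrite /eucl_norm -[leRHS]ger0_norm ?mulr_ge0// -sqrtr_sqr ler_sqrt ?sqr_ge0//.
rewrite (@le_trans _ _ (n%:R * `|v| ^+ 2))//.
  rewrite -[n in n%:R]card_ord mulr_natl -sumr_const ler_sum// => i _.
  by rewrite -real_normK ?num_real// ler_pXn2r ?nnegrE// ler_entry_norm.
rewrite exprMn ler_wpM2r ?sqr_ge0// -natrX ler_nat.
by case: n => // k; rewrite leq_pmull.
Qed.

Lemma norm_le_eucl (v : 'rV[R]_n) : `|v| <= eucl_norm v.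
Proof.
apply: ler_norm_entries => [|i j]; first exact: sqrtr_ge0.
rewrite ord1 -sqrtr_sqr ler_sqrt ?sumr_ge0// => [|k _]; last exact: sqr_ge0.
by rewrite (bigD1 j)//= lerDl sumr_ge0// => k _; exact: sqr_ge0.
Qed.

Lemma jet_norm_le J : jet_norm J <= n.+1%:R * `|J|.
Proof.
case: J => [[r p] A]; rewrite /jet_norm !prod_normE/=.
set N := Num.max (Num.max _ _) _.
have rN : `|r| <= N by rewrite /N !le_max lexx.
have pN : `|p| <= N by rewrite /N !le_max lexx orbT.
have AN : `|A| <= N by rewrite /N !le_max lexx !orbT.
have N0 : 0 <= N by exact: le_trans rN.
rewrite !ge_max; apply/and3P; split.
- by rewrite (le_trans rN)// ler_peMl// ler1n.
- by rewrite (le_trans (eucl_norm_le _))// ler_pM// ler_nat.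
- by rewrite (le_trans (eig_norm_le _))// ler_pM// ler_nat.
Qed.

(** Shifting A by c shifts its eigenvalues, which are at least - c. *)
Lemma psd_shift A c : eig_norm A <= c -> psd (A + scalar_symmetric c).
Proof.
move=> Ac v; rewrite -[X in 0 <= X]/(bform _ _ _).
apply: eigenvalues_ge0_bform; first exact: symm_trmx.
move=> l /eigenvalueP[w wl w0]; have : eigenvalue (symm_val A) (l - c).
  apply/eigenvalueP; exists w => //; rewrite scalerBl -wl mulmxDr.
  by rewrite mul_mx_scalar addrK.
move=> /eig_norm_ge/le_trans/(_ Ac); rewrite ler_norml => /andP[+ _].
by rewrite lerBrDl subrr.
Qed.

Lemma cone_interior_ball (V : normedModType R) (M : set V) v :
  (forall (t : R) z, 0 <= t -> M z -> M (t *: z)) -> M° v ->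
  exists2 e : R, 0 < e &
    forall (t : R) w, 0 < t -> `|w| < t * e -> M (t *: v + w).
Proof.
move=> ZM /nbhs_normP[e /= e0 eM]; exists e => // t w t0 wt.
have -> : t *: v + w = t *: (v + t^-1 *: w).
  by rewrite scalerDr scalerA divff ?gt_eqF// scale1r.
apply: ZM; first exact: ltW.
apply: eM; rewrite /= opprD addNKr normrN normrZ gtr0_norm ?invr_gt0//.
by rewrite mulrC ltr_pdivrMr// mulrC.
Qed.

(** A jet D = (r, p, A) whose jet norm is at most c dominates (r, p, - c I) in
the sense of (P), and the entrywise norm of the latter is at most c. So small
jet norm is as good as small norm for membership in a set satisfying (P). *)
Lemma cone_interior_jet_ball (M : set (J2 R n)) J0 :
  (forall (t : R) J, 0 <= t -> M J -> M (t *: J)) -> axiomP M -> M° J0 ->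
  exists2 e : R, 0 < e &
    forall (t : R) D, 0 < t -> jet_norm D < t * e -> M (t *: J0 + D).
Proof.
move=> ZM PM MJ0; have [e e0 eM] := cone_interior_ball ZM MJ0.
exists (e / 2) => [|t [[r p] A] t0]; first by rewrite divr_gt0.
set c := t * (e / 2); have c0 : 0 < c by rewrite mulr_gt0// divr_gt0.
rewrite /jet_norm !gt_max /= => /and3P[rc pc Ac].
pose D' : J2 R n := (r, p, scalar_symmetric (- c)).
have MD' : M (t *: J0 + D').
  apply: eM => //; apply: (@le_lt_trans _ _ c); last first.
    by rewrite /c ltr_pM2l// ltr_pdivrMr// ltr_pMr// ltr1n.
  rewrite !prod_normE/= !ge_max (ltW rc) (le_trans (norm_le_eucl _) (ltW pc))/=.
  apply: ler_norm_entries => [|i j]; first exact: ltW.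
  rewrite mxE; case: eqP => _; first by rewrite mulr1n normrN gtr0_norm.
  by rewrite mulr0n normr0 ltW.
have -> : t *: J0 + (r, p, A) = ((t *: J0 + D').1.1, (t *: J0 + D').1.2,
    (t *: J0 + D').2 + (A + scalar_symmetric c)).
  congr (_, _); rewrite /= -addrA; congr (_ + _); rewrite addrCA.
  suff -> : scalar_symmetric (- c) + scalar_symmetric c = 0 by rewrite addr0.
  by apply: val_inj; rewrite /= -raddfD/= addNr raddf0.
apply: PM; last exact/psd_shift/ltW.
by rewrite -!surjective_pairing.
Qed.

End JetNorm.

(** * Fiberegularity through translations *)

Section TranslationRegularity.
Variables (R : realType) (n : nat).
Implicit Types (X : set 'rV[R]_n) (M : set (J2 R n)).
Implicit Types (E : set ('rV[R]_n * J2 R n)) (x y : 'rV[R]_n) (J : J2 R n).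

Lemma in_xsection E x J : xsection E x J = E (x, J).
Proof. by rewrite xsectionE. Qed.

(** Both inclusions are required because the Hausdorff distance bounds the
excess of each fiber over the other. *)
Definition translation_regular X E J0 : Prop :=
  forall x, X x -> forall eta : R, 0 < eta ->
    \forall y \near x, forall J,
      (xsection E x J -> xsection E y (J + eta *: J0)) /\
      (xsection E y J -> xsection E x (J + eta *: J0)).

Lemma hausdorff_dist_lt (A B : set (J2 R n)) (e : R) :
  (hausdorff_dist A B < e%:E)%E ->
  (forall J, A J -> exists2 J', B J' & jet_norm (J - J') < e) /\
  (forall J, B J -> exists2 J', A J' & jet_norm (J - J') < e).
Proof.
have excess (C D : set (J2 R n)) :
    (ereal_sup [set ereal_inf [set (jet_norm (J - J'))%:E | J' in D]
      | J in C] < e%:E)%E ->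
    forall J, C J -> exists2 J', D J' & jet_norm (J - J') < e.
  move=> CDe J CJ; have [|_ [J' DJ' <-]] := @ereal_inf_lt _
      [set (jet_norm (J - J'))%:E | J' in D] e%:E; last by exists J'.
  by apply: le_lt_trans CDe; apply: ereal_sup_ubound; exists J.
by rewrite /hausdorff_dist !gt_max => /and3P[_ /excess + /excess].
Qed.

Lemma hausdorff_dist_le (A B : set (J2 R n)) (e : R) : 0 <= e ->
  (forall J, A J -> exists2 J', B J' & jet_norm (J - J') <= e) ->
  (forall J, B J -> exists2 J', A J' & jet_norm (J - J') <= e) ->
  (hausdorff_dist A B <= e%:E)%E.
Proof.
move=> e0; have excess (C D : set (J2 R n)) :
    (forall J, C J -> exists2 J', D J' & jet_norm (J - J') <= e) ->
    (ereal_sup [set ereal_inf [set (jet_norm (J - J'))%:E | J' in D]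
      | J in C] <= e%:E)%E.
  move=> CD; apply: ge_ereal_sup => _ [J /CD[J' DJ' JJ'] <-].
  apply: (@le_trans _ _ (jet_norm (J - J'))%:E); last by rewrite lee_fin.
  by apply: ereal_inf_lbound; exists J'.
by move=> AB BA; rewrite /hausdorff_dist !ge_max lee_fin e0 !excess.
Qed.

(** If J is in E_x and J' in E_y is close to J, then J + eta J0 is the sum of J'
and of eta J0 + (J - J'), which is in M. *)
Lemma fiberegular_translation_regular X M E J0 : open X -> axiomP M ->
  (forall (t : R) J, 0 <= t -> M J -> M (t *: J)) -> M° J0 ->
  cone_monotone X M E -> fiberegular X E -> translation_regular X E J0.
Proof.
move=> oX PM ZM MJ0 ME fE x Xx eta eta0.
have [e e0 eM] := cone_interior_jet_ball ZM PM MJ0.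
have slide y y' : X y' ->
    (forall J, xsection E y J -> exists2 J', xsection E y' J' &
      jet_norm (J - J') < eta * e) ->
    forall J, xsection E y J -> xsection E y' (J + eta *: J0).
  move=> Xy' yy' J /yy'[J' EJ' JJ'].
  have -> : J + eta *: J0 = J' + (eta *: J0 + (J - J')).
    by rewrite addrCA [J' + _]addrC subrK addrC.
  by apply: ME => //; exact: eM.
have := fE x Xx (eta * e) (mulr_gt0 eta0 e0).
rewrite near_withinE => near_x; have := open_nbhs_nbhs (conj oX Xx).
apply: filterS2 near_x => y near_y Xy J.
have [xy yx] := hausdorff_dist_lt (near_y Xy).
by split; apply: slide.
Qed.

(** The translation moves each jet by the norm of eta J0 only. *)
Lemma translation_regular_fiberegular X E J0 :
  translation_regular X E J0 -> fiberegular X E.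
Proof.
move=> slide x Xx e e0.
(* The 1 makes c positive when J0 = 0. *)
pose c : R := n.+1%:R * `|J0| + 1.
have c0 : 0 < c by rewrite ltr_wpDl// mulr_ge0.
pose eta := e / 2 / c; have eta0 : 0 < eta by rewrite !divr_gt0.
have shift J : jet_norm (J - (J + eta *: J0)) <= e / 2.
  rewrite opprD addNKr (le_trans (jet_norm_le _))// normrN normrZ gtr0_norm//.
  by rewrite mulrCA /eta mulrAC ler_pdivrMr// ler_pM2l ?divr_gt0// /c lerDl.
rewrite near_withinE.
have := slide x Xx eta eta0; apply: filterS => y near_y _.
apply: (@le_lt_trans _ _ (e / 2)%:E); last first.
  by rewrite lte_fin ltr_pdivrMr// ltr_pMr// ltr1n.
apply: hausdorff_dist_le => [|J EJ|J EJ]; first by rewrite divr_ge0 ?ltW.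
- by exists (J + eta *: J0); [apply: (near_y J).1|exact: shift].
- by exists (J + eta *: J0); [apply: (near_y J).2|exact: shift].
Qed.

Lemma closure_ray (V : normedModType R) (S : set V) (z v : V) :
  (forall eta : R, 0 < eta -> S (z + eta *: v)) -> closure S z.
Proof.
move=> Sz B /nbhs_normP[e /= e0 eB].
have v1 : 0 < `|v| + 1 by rewrite ltr_wpDl.
pose eta := e / (`|v| + 1); have eta0 : 0 < eta by rewrite divr_gt0.
exists (z + eta *: v); split; first exact: Sz.
apply: eB; rewrite /= opprD addNKr normrN normrZ gtr0_norm// /eta mulrAC.
by rewrite ltr_pdivrMr// ltr_pM2l// ltrDl.
Qed.

(** Half of the translation carries J to the fibers over all y near x, and the
other half stays in M under small perturbations. *)
Lemma translation_interior X M E J0 x J (eta : R) : open X ->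
  (forall (t : R) J, 0 <= t -> M J -> M (t *: J)) -> M° J0 ->
  cone_monotone X M E -> translation_regular X E J0 ->
  X x -> xsection E x J -> 0 < eta -> E° (x, J + eta *: J0).
Proof.
move=> oX ZM MJ0 ME slide Xx EJ eta0.
have [e e0 eM] := cone_interior_ball ZM MJ0.
have h0 : 0 < eta / 2 by rewrite divr_gt0.
exists ([set y | X y /\ xsection E y (J + (eta / 2) *: J0)],
        ball (J + eta *: J0) (eta / 2 * e)).
  split=> /=; last by apply: nbhsx_ballx; rewrite mulr_gt0.
  have := open_nbhs_nbhs (conj oX Xx).
  apply: filterS2 (slide x Xx _ h0) => y near_y Xy; split=> //.
  exact: (near_y J).1.
move=> [y J'] [/= [Xy EyJ]]; rewrite -ball_normE /= => J'J.
rewrite -[E _]in_xsection.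
set h := eta / 2 in h0 EyJ J'J.
have -> : J' = J + h *: J0 + (h *: J0 + (J' - (J + eta *: J0))).
  rewrite [RHS]addrA -[J + _ + _]addrA -scalerDl -splitr.
  by rewrite addrC subrK.
by apply: ME => //; apply: eM; rewrite // distrC.
Qed.

Lemma monotone_axiomP X M E : axiomP M -> M 0 -> cone_monotone X M E ->
  forall x, X x -> axiomP (xsection E x).
Proof.
move=> PM M0 ME x Xx r p A P EJ P0.
have -> : (r, p, A + P) = (r, p, A) + (0, 0, P) :> J2 R n.
  by congr (_, _, _); rewrite /= addr0.
apply: ME => //; rewrite -[P]add0r; exact: PM.
Qed.

Lemma monotone_axiomN X M E : axiomN M -> M 0 -> cone_monotone X M E ->
  forall x, X x -> axiomN (xsection E x).
Proof.
move=> NM M0 ME x Xx r p A s EJ s0.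
have -> : (r + s, p, A) = (r, p, A) + (s, 0, 0) :> J2 R n.
  by congr (_, _, _); rewrite /= addr0.
apply: ME => //; rewrite -[s]add0r; exact: NM.
Qed.

(** Every inclusion of (T) that is not a matter of closedness comes from
[translation_interior], applied either at J, with eta tending to 0, or at
J - t J0. *)
Lemma translation_regular_subequation X M E V J0 :
  open X -> monotonicity_cone M -> M° J0 -> cone_monotone X M E ->
  translation_regular X E J0 -> closed V -> E = V `&` jets X -> subequation X E.
Proof.
move=> oX [[[J1 MJ1] _ _ ZM] [PM NM _]] MJ0 ME slide cV EV.
have M0 : M 0 by rewrite -(scale0r J1); exact: ZM.
have EX : E `<=` jets X by rewrite EV; exact: subIsetr.
have intE x J eta (Xx : X x) (EJ : xsection E x J) (eta0 : 0 < eta) :=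
  translation_interior oX ZM MJ0 ME slide Xx EJ eta0.
have pair_continuous x : continuous (fun J : J2 R n => (x, J)).
  by move=> J; exact: (cvg_pair (cvg_cst x) cvg_id).
have int_section x J : E° (x, J) -> (xsection E x)° J.
  move=> EJ; have : nbhs J ((fun J' => (x, J')) @^-1` E).
    exact: pair_continuous x J _ EJ.
  by apply: filterS => J'; rewrite in_xsection.
have section_closed x : X x -> closed (xsection E x).
  move=> Xx; have -> : xsection E x = (fun J => (x, J)) @^-1` V.
    by apply/seteqP; split=> J; rewrite in_xsection EV => // -[].
  by have /continuous_closedP := pair_continuous x; apply.
split=> //; [exact: monotone_axiomP M0 ME|exact: monotone_axiomN M0 ME|split].
- apply/seteqP; split=> [[x J] EJ|].
    split; last exact: EX.
    apply: (closure_ray (v := (0, J0))) => eta eta0.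
    have -> : (x, J) + eta *: (0, J0) = (x, J + eta *: J0).
      by congr (_, _); rewrite /= scaler0 addr0.
    by apply: intE => //; [exact: (EX _ EJ)|rewrite in_xsection].
  rewrite [Y in _ `<=` Y]EV; apply: setSI.
  rewrite [Y in _ `<=` Y](closure_id V).1//; apply: closureS.
  by apply: subset_trans (@interior_subset _ _) _; rewrite EV; exact: subIsetl.
- move=> x Xx; apply/seteqP; split=> [J EJ|].
    by apply: (closure_ray (v := J0)) => eta eta0; exact/int_section/intE.
  rewrite [Y in _ `<=` Y](closure_id _).1; last exact: section_closed.
  by apply: closureS; exact: interior_subset.
- move=> x Xx; apply/seteqP; split=> J; rewrite in_xsection.
    exact: int_section.
  move=> intJ; have [t t0 EJt] : exists2 t, 0 < t & xsection E x (J - t *: J0).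
    have /nbhs_normP[e /= e0 eE] := intJ.
    have c0 : 0 < `|J0| + 1 by rewrite ltr_wpDl.
    exists (e / (`|J0| + 1)); first by rewrite divr_gt0.
    apply: eE; rewrite /= opprB addrC subrK normrZ gtr0_norm ?divr_gt0//.
    by rewrite mulrAC ltr_pdivrMr// ltr_pM2l// ltrDl.
  by rewrite -(subrK (t *: J0) J); exact: intE.
Qed.

End TranslationRegularity.

(** * The constraint set *)

Section ConstraintSet.
Variables (R : realType) (n : nat).
Implicit Types (X : set 'rV[R]_n) (M : set (J2 R n)).
Implicit Types (F : 'rV[R]_n * J2 R n -> R) (G : set ('rV[R]_n * J2 R n)).

(** F does not decrease along the translations carrying G_x into G_y and G_y
into G_x, so they preserve the constraint F >= 0. The regularity condition is
local in X, hence the compactly contained ball W around x. *)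
Lemma constraint_translation_regular X F G J0 : open X ->
  translation_regular X G J0 -> fiber_regular_fun X F G J0 ->
  translation_regular X (constraint_set F G) J0.
Proof.
move=> oX slide regF x Xx eta eta0.
have [W [Wx cW]] : exists W, W x /\ compactly_contained W X.
  have /nbhs_normP[e /= e0 eX] := open_nbhs_nbhs (conj oX Xx).
  exists (ball x (e / 2)); split; first by apply: ballxx; rewrite divr_gt0.
  have cB : closure (ball x (e / 2)) `<=` closed_ball_ Num.Def.normr x (e / 2).
    rewrite [Y in _ `<=` Y](closure_id _).1; last exact: closed_closed_ball_.
    by apply: closureS => y; rewrite -ball_normE => /ltW.
  split; [apply: ball_open; rewrite divr_gt0|apply: bounded_closed_compact|].
  - exists (`|x| + e / 2); split=> [|c cx y /cB /= xy]; first exact: num_real.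
    rewrite (le_trans _ (ltW cx))// -[y](subKr x).
    by rewrite (le_trans (ler_normB _ _))// lerD2l.
  - exact: closed_closure.
  - move=> y /cB /= xy; apply: eX; rewrite /= (le_lt_trans xy)//.
    by rewrite ltr_pdivrMr// ltr_pMr// ltr1n.
have [d d0 Fd] := regF W eta cW eta0.
have oW : open W by case: cW.
have near_d :
    \forall y \near x, eucl_norm (x - y) < d /\ eucl_norm (y - x) < d.
  have c0 : 0 < n.+1%:R :> R by [].
  have : \forall y \near x, `|x - y| < d / n.+1%:R.
    by apply/nbhs_normP; exists (d / n.+1%:R) => //=; rewrite divr_gt0.
  apply: filterS => y xy.
  have le_d (z : 'rV[R]_n) : `|z| < d / n.+1%:R -> eucl_norm z < d.
    rewrite ltr_pdivlMr// => zd; apply: le_lt_trans (eucl_norm_le z) _.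
    by apply: le_lt_trans zd; rewrite [leRHS]mulrC ler_wpM2r// ler_nat.
  by split; apply: le_d; rewrite // distrC.
have := open_nbhs_nbhs (conj oW Wx).
apply: filterS3 (slide x Xx eta eta0) near_d => y near_y [xy yx] Wy J.
split; rewrite !in_xsection => -[GJ FJ].
- have GJ' : xsection G y (J + eta *: J0).
    by apply: (near_y J).1; rewrite in_xsection.
  split; first by rewrite -in_xsection.
  by apply: (le_trans FJ); apply: Fd => //; rewrite in_xsection.
- have GJ' : xsection G x (J + eta *: J0).
    by apply: (near_y J).2; rewrite in_xsection.
  split; first by rewrite -in_xsection.
  by apply: (le_trans FJ); apply: Fd => //; rewrite in_xsection.
Qed.

Lemma constraint_closed X M F G : monotone_pair X M F G ->
  exists2 V, closed V & constraint_set F G = V `&` jets X.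
Proof.
case=> Gpair cF _.
have [V0 cV0 GV0] : exists2 V, closed V & G = V `&` jets X.
  case: Gpair => [->|[[_ _ _ [GX _ _]] _ _ _]].
    by exists setT; [exact: closedT|rewrite setTI].
  by exists (closure G°); [exact: closed_closure|].
have /continuous_closedP/(_ _ (@closed_ge _ 0)) := cF.
move=> /closed_subspaceP[V1 cV1 GV1].
exists (V1 `&` V0); first exact: closedI.
by rewrite -setIA -GV0 GV1 setIC.
Qed.

Lemma constraint_monotone X M F G : monotone_pair X M F G ->
  cone_monotone X M (constraint_set F G).
Proof.
case=> Gpair _ FM x J J' Xx; rewrite in_xsection => -[GJ FJ] MJ'.
rewrite -in_xsection in GJ.
rewrite in_xsection; split; last by apply: le_trans FJ _; exact: FM.
rewrite -in_xsection.
by case: Gpair => [->|[_ MG _ _]]; [rewrite in_xsection|exact: MG].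
Qed.

End ConstraintSet.

Theorem theorem7p11 (R : realType) (n : nat) (X : set 'rV[R]_n)
    (M : set (J2 R n)) (F : 'rV[R]_n * J2 R n -> R)
    (G : set ('rV[R]_n * J2 R n)) (J0 : J2 R n)
    (openX : open X) (coneM : monotonicity_cone M)
    (pairFG : monotone_pair X M F G) (fibG : fiberegular X G)
    (intJ0 : M° J0) (regF : fiber_regular_fun X F G J0) :
  [/\ subequation X (constraint_set F G),
      cone_monotone X M (constraint_set F G) &
      fiberegular X (constraint_set F G)] /\
  ((forall x, X x -> exists2 J, xsection G x J & F (x, J) = 0) ->
    forall x, X x -> xsection (constraint_set F G) x !=set0) /\
  (constrained X M G ->
    forall x, X x -> xsection (constraint_set F G) x != setT) /\
  (G = jets X -> (forall x, X x -> exists J, F (x, J) < 0) ->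
    forall x, X x -> xsection (constraint_set F G) x != setT).
Proof.
have [[_ _ _ ZM] [PM NM _]] := coneM.
have MG : cone_monotone X M G.
  case: (pairFG) => -[->|[]//] _ _ x J J' Xx _ _.
  by rewrite in_xsection.
have slideG := fiberegular_translation_regular openX PM ZM intJ0 MG fibG.
have slideF := constraint_translation_regular openX slideG regF.
have monoF := constraint_monotone pairFG.
have [V cV FV] := constraint_closed pairFG.
split; first split=> //.
- exact: translation_regular_subequation openX coneM intJ0 monoF slideF cV FV.
- exact: translation_regular_fiberegular slideF.
split=> [F0 x Xx|].
  have [J GJ FJ] := F0 x Xx; exists J; rewrite in_xsection.
  by split; [rewrite -in_xsection|rewrite FJ].
split=> [[_ _ _ GT] x Xx|_ F0 x Xx].
  apply: contra_neq (GT x Xx) => FT; rewrite -subTset -FT => J.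
  by rewrite !in_xsection => -[].
have [J FJ] := F0 x Xx; apply/eqP => FT.
have : xsection (constraint_set F G) x J by rewrite FT.
by rewrite in_xsection => -[_]; rewrite leNgt FJ.
Qed.
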